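(* Consider a set of producers $\mathcal N$, production cost functions $C_i$ for every $i\in\mathcal N$, and the affine demand function $D(p)=\gamma(\hat p-p)$ with $\gamma>0$ and $\hat p>0$. If the marginal costs in $0$ are homogeneous, i.e., $C_i'(0)=C_j'(0)$ for all $i,j\in\mathcal N$, then the activation price game admits a unique Nash equilibrium $x^*$. Moreover, the activation prices at equilibrium satisfy $$\tilde p(x^* )-(n+\gamma)x_i^*+(n+\gamma-1)\,C_i'(\tilde p(x^* )-x_i^* )=0$$ for every $i\in\mathcal N$, where $$\tilde p(x)=\frac{\gamma\hat p+\sum_{j=1}^n x_j}{n+\gamma}.$$
   Context: Notation: $\mathbb R_+=[0,\infty)$, $[t]_+=\max\{t,0\}$. Market: $\mathcal N=\{1,\dots,n\}$ is a non-empty finite set of producers. Each production cost function $C_i:\mathbb R_+\to\mathbb R_+$ is twice continuously differentiable, non-decreasing and convex. The demand function is $D(p)=\gamma(\hat p-p)$. Activation price game: the strategic game with player set $\mathcal N$, in which each player $i$ chooses $x_i\in[0,\hat p]$ (its activation price); for $x\in[0,\hat p]^{\mathcal N}$ the market-clearing price $\overline p(x)$ is the unique $\overline p\in[0,\hat p]$ with $D(\overline p)=\sum_{i=1}^n[\overline p-x_i]_+$, and the utility of player $i$ is $$\overline u_i(x)=\overline p\,[\overline p-x_i]_+-\tfrac12[\overline p-x_i]_+^2-C_i([\overline p-x_i]_+),\qquad \overline p=\overline p(x).$$ $x^*$ is a Nash equilibrium if for every $i$, $x_i^*$ maximizes $\overline u_i(\cdot,x_{-i}^* )$ over $[0,\hat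 p]$.
   Formalization: The displayed equation for the equilibrium activation prices is proved under the added condition C_i'(0) ≤ p̂ for all i, without which it fails (e.g. n=γ=p̂=1, C(q)=2q); existence and uniqueness need no added condition. *)

(* Defs.v *)
From HB Require Import structures.
From mathcomp Require Import all_boot all_order all_algebra.
From mathcomp Require Import all_classical all_reals all_analysis.
From mathcomp Require Import ring lra.

Set Implicit Arguments.
Unset Strict Implicit.
Unset Printing Implicit Defensive.

Import Order.TTheory GRing.Theory Num.Theory.
Import numFieldNormedType.Exports.

Local Open Scope classical_set_scope.
Local Open Scope ring_scope.

Definition Rplus (R : realType) : set R := `[0, +oo[%classic.

(* Functions on R_+ are functions R -> R of which only the values on Rplus are
   used.  Difference quotients are therefore taken relative to R_+: at x > 0
   this is the usual derivative, at 0 it is the right derivative. *)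
Definition Rplus_quotient (R : realType) (f : R -> R) (x : R) : set_system R :=
  (f y - f x) / (y - x) @[y --> within (@Rplus R) x^'].

Definition Rplus_derivable (R : realType) (f : R -> R) (x : R) : Prop :=
  cvg (Rplus_quotient f x).

Definition Rplus_derive (R : realType) (f : R -> R) (x : R) : R :=
  lim (Rplus_quotient f x).

Definition Rplus_C2 (R : realType) (f : R -> R) : Prop :=
  [/\ forall x : R, 0 <= x -> Rplus_derivable f x,
      forall x : R, 0 <= x -> Rplus_derivable (Rplus_derive f) x &
      {within @Rplus R, continuous (Rplus_derive (Rplus_derive f))}].

Definition production_cost (R : realType) (C : R -> R) : Prop :=
  [/\ forall q : R, 0 <= q -> 0 <= C q,
      Rplus_C2 C,
      {in @Rplus R &, {homo C : q r / q <= r}} &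
      convex_function (@Rplus R) C].

Definition pospart (R : realType) (t : R) : R := Num.max t 0.

Definition demand (R : realType) (gamma phat p : R) : R := gamma * (phat - p).

Definition is_clearing_price (R : realType) (n : nat) (gamma phat : R)
    (x : 'I_n -> R) (p : R) : Prop :=
  p \in `[0, phat] /\ demand gamma phat p = \sum_(i < n) pospart (p - x i).

(* On admissible profiles, [clearing_price_spec] below shows that exactly one
   price clears the market; outside of them the default 0 may be returned. *)
Definition clearing_price (R : realType) (n : nat) (gamma phat : R)
    (x : 'I_n -> R) : R :=
  xget 0 [set p | is_clearing_price gamma phat x p].

Definition utility (R : realType) (n : nat) (gamma phat : R)
    (C : 'I_n -> R -> R) (i : 'I_n) (x : 'I_n -> R) : R :=
  let p := clearing_price gamma phat x in
  let q := pospart (p - x i) in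
  p * q - q ^+ 2 / 2 - C i q.

(* [eta x with i |-> t] is the profile (t, x_{-i}). *)
Definition nash_equilibrium (R : realType) (n : nat) (S : set R)
    (u : 'I_n -> ('I_n -> R) -> R) (x : 'I_n -> R) : Prop :=
  (forall i, S (x i)) /\
  (forall i (t : R), S t -> u i [eta x with i |-> t] <= u i x).

Definition activation_price_equilibrium (R : realType) (n : nat)
    (gamma phat : R) (C : 'I_n -> R -> R) (x : 'I_n -> R) : Prop :=
  nash_equilibrium `[0, phat]%classic (utility gamma phat C) x.

Definition ptilde (R : realType) (n : nat) (gamma phat : R)
    (x : 'I_n -> R) : R :=
  (gamma * phat + \sum_(j < n) x j) / (n%:R + gamma).

Lemma clearing_price_exists_unique (R : realType) (n : nat) (gamma phat : R)
    (x : 'I_n -> R) :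
  0 < gamma -> 0 < phat -> (forall i, x i \in `[0, phat]) ->
  exists! p : R, is_clearing_price gamma phat x p.
Proof.
move=> g0 p0 hx.
pose S (p : R) : R := \sum_(i < n) pospart (p - x i).
have S_homo p q : p <= q -> S p <= S q.
  move=> pq; apply: ler_sum => i _; rewrite /pospart.
  by rewrite ge_max !le_max lexx orbT andbT lerD2r pq.
have S_ge0 p : 0 <= S p.
  by apply: sumr_ge0 => i _; rewrite /pospart le_max lexx orbT.
have S0 : S 0 = 0.
  apply: big1 => i _; rewrite /pospart; apply/max_idPr.
  by have := hx i; rewrite in_itv/= sub0r oppr_le0 => /andP[].
have Scont : continuous S.
  apply: continuous_big => [|i _ p]; first exact: add_continuous.
  apply: (@continuous_max R R (fun p : R => p - x i) (fun=> 0)).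
    by apply: cvgB; [exact: cvg_id|exact: cvg_cst].
  exact: cvg_cst.
pose f p := S p - gamma * (phat - p).
have fcont : continuous f.
  move=> p; apply: cvgB; first exact: Scont.
  apply: cvgM; first exact: cvg_cst.
  by apply: cvgB; [exact: cvg_cst|exact: cvg_id].
have f0 : f 0 <= 0 by rewrite /f S0 subr0 sub0r oppr_le0 ltW// mulr_gt0.
have fp : 0 <= f phat by rewrite /f subrr mulr0 subr0.
have [|p pI fp0] := @IVT R f 0 phat 0 (ltW p0) (continuous_subspaceT fcont).
  by rewrite ge_min f0 le_max fp orbT.
have clr q : is_clearing_price gamma phat x q -> f q = 0.
  by move=> [_ /eqP]; rewrite eq_sym -subr_eq0 => /eqP.
have f_incr q r : q < r -> f q < f r.
  move=> qr; rewrite /f; have := S_homo _ _ (ltW qr).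
  have : gamma * (phat - r) < gamma * (phat - q) by rewrite ltr_pM2l// ltrD2l ltrN2.
  by lra.
exists p; split.
  by split=> //; apply/esym/eqP; rewrite -subr_eq0; apply/eqP.
move=> q /clr fq; apply/eqP; case: (ltgtP p q) => // /f_incr.
  by rewrite fp0 fq ltxx.
by rewrite fp0 fq ltxx.
Qed.

Lemma clearing_price_spec (R : realType) (n : nat) (gamma phat : R)
    (x : 'I_n -> R) (p : R) :
  0 < gamma -> 0 < phat -> (forall i, x i \in `[0, phat]) ->
  is_clearing_price gamma phat x p <-> p = clearing_price gamma phat x.
Proof.
move=> g0 p0 hx; have [q [hq uq]] := clearing_price_exists_unique g0 p0 hx.
have hc : is_clearing_price gamma phat x (clearing_price gamma phat x).
  exact: (@xgetPex _ 0 [set p | is_clearing_price gamma phat x p]) (ex_intro _ q hq).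
by split=> [hp|->//]; rewrite -(uq _ hp) -(uq _ hc).
Qed.

(* Main.v *)
Require Import Defs.
From HB Require Import structures.
From mathcomp Require Import all_boot all_order all_algebra.
From mathcomp Require Import all_classical all_reals all_analysis.
From mathcomp Require Import ring lra.

Import Order.TTheory GRing.Theory Num.Theory.
Import numFieldNormedType.Exports.

Local Open Scope ring_scope.

(** Put m = n + gamma - 1.  Against fixed activation prices of the others, a
    producer who activates at t effectively chooses a point (p, q) on its
    residual demand curve q = gamma (phat - p) - (supply of the others at p),
    and receives p q - q^2 / 2 - C_i q.  Where all the others are active this
    curve has slope - m, and the first-order condition in q reads

      q + q / m + C_i' q = p.

    The proof identifies the equilibria with the solutions of a monotone system.
    Say that q is the supply of i at price p ([supply_at]) when q >= 0,
    p <= q + q / m + C_i' q, and equality holds if q > 0.  As C_i' is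
    nondecreasing and continuous, each p has exactly one such q, which is a
    nondecreasing and 1-Lipschitz function of p.  The total supply is therefore
    nondecreasing and continuous while the demand is strictly decreasing, so
    there is exactly one (p, q) for which these supplies clear the market
    ([supply_clears_exists], [supply_clears_uniq]).

    Such a solution gives an equilibrium x_i = p - q_i
    ([supply_clears_equilibrium]): the positive part being convex, the residual
    demand curve lies below its line of slope - m through (p, q_i), and C_i lies
    above its tangent at q_i; with these two bounds, a deviation that changes
    the quantity by d changes the payoff by at most - (1 / m + 1 / 2) d^2.  This
    direction does not need homogeneous marginal costs.

    Conversely ([equilibrium_supply_clears]), at an equilibrium a producer with
    p <= C_i' 0 sells nothing, since it would do better by leaving the market
    ([equilibrium_no_supply]), and a producer that sells nothing has
    p <= C_i' 0, since it would otherwise gain by entering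
    ([equilibrium_inactive]).  As C_i' 0 does not depend on i, either nobody is
    active, and then p = phat = x_i for all i, or everybody is, and then the
    first-order condition holds ([equilibrium_FOC]).  Both cases solve the
    system.  When C_i' 0 <= phat the first-order equation holds in both cases,
    and it is the announced equation up to the factor m, because
    p = ptilde x as soon as no x_i exceeds p. *)

(** * Derivatives relative to the half-line *)

Lemma Rplus_deriveP {R : realType} {f : R -> R} {x : R} :
  Rplus_derivable f x ->
  forall e : R, 0 < e -> exists2 d : R, 0 < d &
    forall y, 0 <= y -> y != x -> `|x - y| < d ->
    `|Rplus_derive f x - (f y - f x) / (y - x)| < e.
Proof.
move=> fx e e0.
have /cvgrPdist_lt /(_ e e0) : (Rplus_quotient f x --> Rplus_derive f x)%classic.
  exact: fx.
rewrite /within/= /dnbhs /within/= => /nbhs_ballP[d /= d0 H].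
exists d => // y y0 yx xy; apply: (H y) => //.
by rewrite /Rplus/= in_itv/= y0.
Qed.

(** It is enough to bound the quotients at points arbitrarily close to x, from
    one side only if convenient; the error allowed is the distance itself. *)
Lemma le_Rplus_derive {R : realType} {f : R -> R} {x b : R} :
  Rplus_derivable f x ->
  (forall e : R, 0 < e -> exists y, [/\ 0 <= y, y != x, `|x - y| < e &
     b - e <= (f y - f x) / (y - x)]) ->
  b <= Rplus_derive f x.
Proof.
move=> fx H; apply/ler_addgt0Pr => e e0.
have e20 : 0 < e / 2 by rewrite divr_gt0.
have [d d0 D] := Rplus_deriveP fx _ e20.
have [|y [y0 yx]] := H (Num.min d (e / 2)); first by rewrite lt_min d0.
rewrite lt_min => /andP[xyd _] qy; have := D y y0 yx xyd.
rewrite ltr_norml => /andP[Dy _].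
have : Num.min d (e / 2) <= e / 2 by rewrite ge_min lexx orbT.
by move: qy Dy; lra.
Qed.

Lemma ge_Rplus_derive {R : realType} {f : R -> R} {x b : R} :
  Rplus_derivable f x ->
  (forall e : R, 0 < e -> exists y, [/\ 0 <= y, y != x, `|x - y| < e &
     (f y - f x) / (y - x) <= b + e]) ->
  Rplus_derive f x <= b.
Proof.
move=> fx H; apply/ler_addgt0Pr => e e0.
have e20 : 0 < e / 2 by rewrite divr_gt0.
have [d d0 D] := Rplus_deriveP fx _ e20.
have [|y [y0 yx]] := H (Num.min d (e / 2)); first by rewrite lt_min d0.
rewrite lt_min => /andP[xyd _] qy; have := D y y0 yx xyd.
rewrite ltr_norml => /andP[_ Dy].
have : Num.min d (e / 2) <= e / 2 by rewrite ge_min lexx orbT.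
by move: qy Dy; lra.
Qed.

Lemma Rplus_derivable_continuous {R : realType} {f : R -> R} {x : R} :
  Rplus_derivable f x ->
  forall e : R, 0 < e -> exists2 d : R, 0 < d &
    forall y, 0 <= y -> `|x - y| < d -> `|f x - f y| < e.
Proof.
move=> fx e e0; have [d d0 D] := Rplus_deriveP fx _ (@ltr01 R).
set K := `|Rplus_derive f x| + 1.
have K0 : 0 < K by rewrite ltr_wpDl.
exists (Num.min d (e / K)); first by rewrite lt_min d0 divr_gt0.
move=> y y0; rewrite lt_min => /andP[xyd]; rewrite ltr_pdivlMr// => xyK.
have [->|yx] := eqVneq y x; first by rewrite subrr normr0.
apply: le_lt_trans xyK; rewrite distrC (distrC x) mulrC.
rewrite -ler_pdivrMr ?normr_gt0 ?subr_eq0// -normf_div /K.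
have := D y y0 yx xyd; set q := _ / _ => Dq.
have -> : q = Rplus_derive f x - (Rplus_derive f x - q) by rewrite opprB addrC subrK.
by apply: (le_trans (ler_normB _ _)); rewrite lerD2l ltW.
Qed.

(** Extending f to the negative reals by f 0 makes it continuous on the whole
    line, so that continuity on intervals needs no relative topology. *)
Lemma continuous_Rplus_extension {R : realType} {f : R -> R} :
  (forall x, 0 <= x -> Rplus_derivable f x) ->
  continuous (fun q : R => f (Num.max q 0)).
Proof.
move=> fd x; apply/cvgrPdist_lt => e e0.
have [|d d0 D] := Rplus_derivable_continuous (fd (Num.max x 0) _) _ e0.
  by rewrite le_max lexx orbT.
apply/nbhs_ballP; exists d => //= y xy.
apply: D; first by rewrite le_max lexx orbT.
apply: le_lt_trans xy; rewrite ler_norml /Order.max.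
have := ler_norm (x - y); have := ler_norm (y - x).
rewrite (distrC y x); move: `|x - y| => a.
by case: (ltP x 0) => x0; case: (ltP y 0) => y0; lra.
Qed.

(** * Production costs and their marginal costs *)

Section Cost.
Context {R : realType} {C : R -> R} (hC : production_cost C).
Local Notation C' := (Rplus_derive C).

Lemma cost_derivable x : 0 <= x -> Rplus_derivable C x.
Proof. by case: hC => _ [h _ _] _ _; exact: h. Qed.

Lemma marginal_cost_derivable x : 0 <= x -> Rplus_derivable C' x.
Proof. by case: hC => _ [_ h _] _ _; exact: h. Qed.

Lemma cost_convex (t x y : R) : 0 <= t <= 1 -> 0 <= x -> 0 <= y ->
  C (t * x + (1 - t) * y) <= t * C x + (1 - t) * C y.
Proof.
move=> /andP[t0 t1] x0 y0; case: hC => _ _ _ cv.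
have := cv (Itv01 t0 t1) x y; rewrite !convRE/=; apply.
  by rewrite inE /Rplus/= in_itv/= x0.
by rewrite inE /Rplus/= in_itv/= y0.
Qed.

Lemma marginal_cost_ge0 x : 0 <= x -> 0 <= C' x.
Proof.
move=> x0; apply: (le_Rplus_derive (cost_derivable _ x0)) => e e0.
exists (x + e / 2); split.
- by rewrite addr_ge0// ltW// divr_gt0.
- by rewrite -subr_eq0 addrAC subrr add0r gt_eqF ?divr_gt0.
- by rewrite opprD addrA subrr add0r normrN gtr0_norm ?divr_gt0//; lra.
- rewrite (@le_trans _ _ 0)//; first by lra.
  rewrite divr_ge0//; last by lra.
  case: hC => _ _ mono _; rewrite subr_ge0.
  by apply: mono; rewrite ?inE /Rplus/= ?in_itv/=; lra.
Qed.

Lemma cost_tangent x y : 0 <= x -> 0 <= y -> C x + C' x * (y - x) <= C y.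
Proof.
move=> x0 y0; have [->|yx] := eqVneq y x; first by rewrite subrr mulr0 addr0.
(* Points of the segment from x to y, arbitrarily close to x. *)
have near (e : R) : 0 < e -> exists t : R, [/\ 0 < t, t <= 1 & t * `|y - x| < e].
  move=> e0; have a0 : 0 < `|y - x| by rewrite normr_gt0 subr_eq0.
  exists (Num.min 1 (e / 2 / `|y - x|)).
  split; [by rewrite lt_min ltr01 !divr_gt0|by rewrite ge_min lexx|].
  rewrite (@le_lt_trans _ _ (e / 2))//; last by lra.
  by rewrite -ler_pdivlMr// ge_min lexx orbT.
set B := (C y - C x) / (y - x).
have BE : B * (y - x) = C y - C x by rewrite divfK// subr_eq0.
have pt (t : R) : 0 < t -> t <= 1 -> let z := t * y + (1 - t) * x in
    [/\ 0 <= z, z != x, z - x = t * (y - x) & C z - C x <= t * (C y - C x)].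
  move=> t0 t1 z.
  have zx : z - x = t * (y - x) by rewrite /z; ring.
  split=> //.
  - by rewrite addr_ge0// mulr_ge0//; lra.
  - rewrite -subr_eq0 zx mulf_neq0 ?subr_eq0 ?yx ?(gt_eqF t0)//.
  - have := @cost_convex t y x; rewrite (ltW t0) t1 => /(_ isT y0 x0).
    rewrite -/z.
    lra.
move: yx; rewrite neq_lt => /orP[yx|xy].
- have : B <= C' x.
    apply: (le_Rplus_derive (cost_derivable _ x0)) => e e0.
    have [t [t0 t1 te]] := near e e0; have [z0 zx zxE Cz] := pt t t0 t1.
    exists (t * y + (1 - t) * x); split=> //.
      by rewrite distrC zxE normrM (gtr0_norm t0).
    rewrite ler_ndivlMr zxE; last by rewrite pmulr_rlt0// subr_lt0.
    apply: (le_trans Cz); rewrite -BE.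
    have : 0 <= e * (t * (x - y)) by rewrite !mulr_ge0//; lra.
    by lra.
  by rewrite -subr_ge0 => h; have := mulr_ge0 h (_ : 0 <= x - y); lra.
- have : C' x <= B.
    apply: (ge_Rplus_derive (cost_derivable _ x0)) => e e0.
    have [t [t0 t1 te]] := near e e0; have [z0 zx zxE Cz] := pt t t0 t1.
    exists (t * y + (1 - t) * x); split=> //.
      by rewrite distrC zxE normrM (gtr0_norm t0).
    rewrite ler_pdivrMr zxE; last by rewrite pmulr_rgt0// subr_gt0.
    apply: (le_trans Cz); rewrite -BE.
    have : 0 <= e * (t * (y - x)) by rewrite !mulr_ge0//; lra.
    by lra.
  by rewrite -subr_ge0 => h; have := mulr_ge0 h (_ : 0 <= y - x); lra.
Qed.

Lemma marginal_cost_homo x y : 0 <= x -> x <= y -> C' x <= C' y.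
Proof.
move=> x0; rewrite le_eqVlt => /orP[/eqP->//|xy].
have y0 : 0 <= y by lra.
have yx : 0 < y - x by lra.
rewrite -(ler_pM2r yx).
by have := cost_tangent x y x0 y0; have := cost_tangent y x y0 x0; lra.
Qed.

End Cost.

(** * The market under a change of one activation price *)

(** What a producer with cost C receives for a quantity q at price p. *)
Definition payoff {R : realType} (C : R -> R) (p q : R) : R :=
  p * q - q ^+ 2 / 2 - C q.

(** The quantity supplied at price p by all the producers but i. *)
Definition others_supply {R : realType} {n : nat} (x : 'I_n -> R) (i : 'I_n)
    (p : R) : R :=
  \sum_(j < n | j != i) pospart (p - x j).

Lemma pospart_ge0 {R : realType} (t : R) : 0 <= pospart t.
Proof. by rewrite /pospart le_max lexx orbT. Qed.

Lemma pospart_ge {R : realType} (t : R) : t <= pospart t.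
Proof. by rewrite /pospart le_max lexx. Qed.

Lemma pospart_id {R : realType} {t : R} : 0 <= t -> pospart t = t.
Proof. by move=> t0; apply/max_idPl. Qed.

Lemma pospart_eq0 {R : realType} {t : R} : t <= 0 -> pospart t = 0.
Proof. by move=> t0; apply/max_idPr. Qed.

Lemma finite_pos_lower_bound {R : realType} {n : nat} {f : 'I_n -> R} :
  (forall i, 0 < f i) -> exists2 d : R, 0 < d & forall i, d <= f i.
Proof.
move=> f0; exists (\big[Num.min/1]_i f i); last by move=> i; exact: bigmin_le_cond.
by apply/bigmin_gtP; split.
Qed.

Section Market.
Context {R : realType} {n : nat} {gamma phat : R}.
Hypotheses (gamma_gt0 : 0 < gamma) (phat_gt0 : 0 < phat).
Local Notation m := (n%:R + gamma - 1).

Lemma slope_gt0 (i : 'I_n) : 0 < m.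
Proof.
have : (0 < n)%N by exact: leq_ltn_trans (ltn_ord i).
rewrite -(ler1n R).
by move: gamma_gt0; lra.
Qed.

Section Profile.
Context {x : 'I_n -> R}.

Lemma supplyD1 (i : 'I_n) (p : R) :
  \sum_(j < n) pospart (p - x j) = pospart (p - x i) + others_supply x i p.
Proof. by rewrite (bigD1 i). Qed.

Lemma sum_price_gap (p : R) : \sum_(j < n) (p - x j) = n%:R * p - \sum_(j < n) x j.
Proof. by rewrite sumrB sumr_const card_ord mulr_natl. Qed.

(** The others supply at least what the affine formula for active producers
    gives, so the residual demand of i lies below a line of slope - m. *)
Lemma others_supply_ge (i : 'I_n) (p : R) :
  n%:R * p - \sum_(j < n) x j - (p - x i) <= others_supply x i p.
Proof.
rewrite -sum_price_gap (bigD1 i)//= addrAC subrr add0r.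
by apply: ler_sum => j _; exact: pospart_ge.
Qed.

Lemma others_supply_active (i : 'I_n) (p : R) : (forall j, j != i -> x j <= p) ->
  others_supply x i p = n%:R * p - \sum_(j < n) x j - (p - x i).
Proof.
move=> xp; rewrite -sum_price_gap [in RHS](bigD1 i)//= addrAC subrr add0r.
by apply: eq_bigr => j ji; rewrite pospart_id// subr_ge0 xp.
Qed.

Hypothesis x_box : forall i, x i \in `[0, phat].

Lemma clearing_price_clears : is_clearing_price gamma phat x (clearing_price gamma phat x).
Proof. exact/(clearing_price_spec _ gamma_gt0 phat_gt0 x_box). Qed.

Lemma update_box (i : 'I_n) (t : R) : t \in `[0, phat] ->
  forall j, [eta x with i |-> t] j \in `[0, phat].
Proof. by move=> tb j /=; case: ifP. Qed.

Lemma update_supply (i : 'I_n) (t p : R) :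
  \sum_(j < n) pospart (p - [eta x with i |-> t] j)
    = pospart (p - t) + others_supply x i p.
Proof.
rewrite (bigD1 i)//= eqxx; congr (_ + _).
by apply: eq_bigr => j /negbTE ->.
Qed.

End Profile.

Context {C : 'I_n -> R -> R}.

Lemma utilityE (x : 'I_n -> R) (i : 'I_n) :
  let p := clearing_price gamma phat x in
  utility gamma phat C i x = payoff (C i) p (pospart (p - x i)).
Proof. by []. Qed.

Lemma utility_update (x : 'I_n -> R) (i : 'I_n) (t : R) :
  let y := [eta x with i |-> t] in let p := clearing_price gamma phat y in
  utility gamma phat C i y = payoff (C i) p (pospart (p - t)).
Proof. by move=> y p; rewrite utilityE -/p /y/= eqxx. Qed.

(** * Necessary conditions at an equilibrium *)

Section Equilibrium.
Context {x : 'I_n -> R} (x_eq : activation_price_equilibrium gamma phat C x).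
Hypothesis C_cost : forall i, production_cost (C i).
Local Notation p := (clearing_price gamma phat x).
Local Notation q := (fun i => pospart (p - x i)).

Lemma equilibrium_box i : x i \in `[0, phat].
Proof. by case: x_eq => + _ => /(_ i). Qed.

Lemma equilibrium_price_itv : 0 <= p <= phat.
Proof. by case: (clearing_price_clears equilibrium_box); rewrite in_itv. Qed.

Lemma equilibrium_clears : gamma * (phat - p) = \sum_(j < n) q j.
Proof. by case: (clearing_price_clears equilibrium_box). Qed.

(** At equilibrium no point (p', d) of the residual demand curve of i is better
    than the current one; it is reached by the activation price p' - d, whence
    the requirement d <= p'. *)
Lemma equilibrium_deviation (i : 'I_n) (p' d : R) :
  0 <= d <= p' -> p' <= phat ->
  gamma * (phat - p') = d + others_supply x i p' ->
  payoff (C i) p' d <= payoff (C i) p (q i).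
Proof.
move=> /andP[d0 dp'] p'hat clr; case: (x_eq) => _ /(_ i (p' - d)).
have tb : p' - d \in `[0, phat] by rewrite in_itv/=; lra.
move=> /(_ tb); rewrite utility_update utilityE.
have <- : p' = clearing_price gamma phat [eta x with i |-> p' - d].
  apply/(clearing_price_spec _ gamma_gt0 phat_gt0 (update_box equilibrium_box _ _ tb)).
  split; first by rewrite in_itv/=; lra.
  by rewrite update_supply subKr pospart_id.
by rewrite subKr (pospart_id d0).
Qed.

(** With activation price phat, a producer sells nothing. *)
Lemma equilibrium_exit (i : 'I_n) : - C i 0 <= payoff (C i) p (q i).
Proof.
case: (x_eq) => _ /(_ i phat).
have tb : phat \in `[0, phat] by rewrite in_itv/= lexx ltW.
move=> /(_ tb); rewrite utility_update utilityE.
have [+ _] := clearing_price_clears (update_box equilibrium_box i _ tb).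
rewrite in_itv/= => /andP[_]; rewrite -subr_le0 => /pospart_eq0 ->.
by rewrite /payoff; apply: le_trans; rewrite mulr0 expr0n mul0r/=; lra.
Qed.

Lemma equilibrium_no_supply (i : 'I_n) : p <= Rplus_derive (C i) 0 -> p <= x i.
Proof.
move=> pc; rewrite leNgt; apply/negP => xp.
have qE : q i = p - x i by rewrite /= pospart_id// subr_ge0 ltW.
have q0 : 0 < q i by rewrite qE subr_gt0.
have := cost_tangent (C_cost i) 0 (q i) (lexx 0) (ltW q0).
have := equilibrium_exit i; rewrite /payoff subr0.
move: (q i) q0 => r r0.
have : 0 <= (Rplus_derive (C i) 0 - p) * r by rewrite mulr_ge0//; lra.
have : 0 < r ^+ 2 by rewrite exprn_gt0.
by lra.
Qed.

(** A producer that sells nothing can push the price down by a small s; the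
    quantity d it then sells has order s, and its profit p d - C_i d + C_i 0 is
    nonpositive up to terms of order d^2. *)
Lemma equilibrium_inactive (i : 'I_n) : p <= x i -> p <= Rplus_derive (C i) 0.
Proof.
move=> pxi; have /andP[p0 ppt] := equilibrium_price_itv.
move: p0; rewrite le_eqVlt => /orP[/eqP <-|p0].
  exact: marginal_cost_ge0.
have qi0 : q i = 0 by apply: pospart_eq0; rewrite subr_le0.
have M1 : 1 <= gamma + n%:R + 1 by have := ler0n R n; have := gamma_gt0; lra.
have M0 : 0 < gamma + n%:R + 1 by lra.
apply: (le_Rplus_derive (cost_derivable (C_cost i) _ (lexx 0))) => e e0.
(* With this s, the quantity d is at most s * (gamma + n), so that s + d is at
   most both e / 2 and p. *)
pose s := Num.min (e / 2) p / (gamma + n%:R + 1).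
have s0 : 0 < s by rewrite divr_gt0// lt_min p0 divr_gt0.
have se : s * (gamma + n%:R + 1) <= e / 2 by rewrite divfK ?gt_eqF// ge_min lexx.
have sp : s * (gamma + n%:R + 1) <= p by rewrite divfK ?gt_eqF// ge_min lexx orbT.
pose d := gamma * (phat - (p - s)) - others_supply x i (p - s).
have clr : gamma * (phat - p) = others_supply x i p.
  by rewrite equilibrium_clears (supplyD1 i) [pospart _]qi0 add0r.
have d_ge : gamma * s <= d.
  have : others_supply x i (p - s) <= others_supply x i p.
    apply: ler_sum => j _; rewrite /pospart ge_max !le_max lexx orbT andbT.
    by apply/orP; left; lra.
  by rewrite -clr /d; lra.
have d_le : d <= s * (gamma + n%:R).
  have le_n : others_supply x i p - others_supply x i (p - s) <= n%:R * s.
    rewrite /others_supply -sumrB mulr_natl -[n in s *+ n]card_ord -sumr_const.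
    rewrite [leRHS](bigD1 i)//= ler_wpDl ?(ltW s0)//.
    apply: ler_sum => j _; rewrite lerBlDr [in leLHS]/pospart ge_max.
    have := pospart_ge (p - s - x j); have := pospart_ge0 (p - s - x j).
    by move=> ? ?; apply/andP; split; lra.
  by move: le_n; rewrite -clr /d; lra.
have d0 : 0 < d by apply: lt_le_trans d_ge; rewrite mulr_gt0.
exists d; split.
- exact: ltW.
- by rewrite gt_eqF.
- by rewrite sub0r normrN gtr0_norm//; lra.
rewrite subr0 ler_pdivlMr//.
have : payoff (C i) (p - s) d <= payoff (C i) p (q i).
  apply: equilibrium_deviation; [by rewrite ltW//=; lra|by lra|by rewrite subrK].
rewrite qi0 /payoff mulr0 expr0n mul0r/=.
have : 0 <= (e - s - d / 2) * d by rewrite mulr_ge0 ?(ltW d0)//; nra.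
by lra.
Qed.

(** Changing the quantity by d moves the price by - d / m as long as everybody
    stays active; the last four hypotheses say that the others stay active and
    that the new quantity, activation price and market price are admissible. *)
Lemma equilibrium_FOC_bound (i : 'I_n) (d : R) :
  (forall j, x j <= p) ->
  (forall j, x j <= p - d / m) -> 0 <= p - x i + d -> d + d / m <= x i ->
  p - d / m <= phat ->
  (p - (p - x i) - (p - x i) / m) * d - (m^-1 + 2^-1) * d ^+ 2
    <= C i (p - x i + d) - C i (p - x i).
Proof.
move=> xp xp' q0 dx p'hat.
have m0 := slope_gt0 i.
have : payoff (C i) (p - d / m) (p - x i + d) <= payoff (C i) p (q i).
  apply: equilibrium_deviation; [by rewrite q0/=; lra|by []|].
  have := equilibrium_clears; rewrite (supplyD1 i) pospart_id ?subr_ge0//.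
  rewrite !others_supply_active//.
  have : m * (d / m) = d by rewrite mulrC divfK ?gt_eqF.
  by lra.
rewrite /= pospart_id ?subr_ge0// /payoff.
by lra.
Qed.

(** Decreasing the quantity is always possible and bounds C_i' from above.  This
    bound would be - q / m < 0 if x_i were 0, while C_i' >= 0; hence x_i > 0 and
    the quantity can be increased as well, which gives the other bound. *)
Lemma equilibrium_FOC (i : 'I_n) : (forall j, x j < p) ->
  p - x i + (p - x i) / m + Rplus_derive (C i) (p - x i) = p.
Proof.
move=> xp; have xpW j : x j <= p by exact: ltW.
have m0 := slope_gt0 i; have mV0 : 0 < m^-1 by rewrite invr_gt0.
have [d0 d0_gt0 d0P] : exists2 d : R, 0 < d & forall j, d <= p - x j.
  by apply: finite_pos_lower_bound => j; rewrite subr_gt0.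
have phat_p : 0 < phat - p.
  rewrite -(pmulr_rgt0 _ gamma_gt0) equilibrium_clears (supplyD1 i).
  rewrite ltr_pwDl// ?sumr_ge0// => [|j _]; last exact: pospart_ge0.
  by rewrite pospart_id ?subr_gt0// subr_ge0.
have q0 : 0 < p - x i by rewrite subr_gt0.
have Cd := cost_derivable (C_cost i) _ (ltW q0).
set A := p - (p - x i) - (p - x i) / m.
set K := m^-1 + 2^-1.
have K0 : 0 < K by rewrite /K; lra.
have K1 : 0 < 1 + K by lra.
have xi0 : 0 <= x i by have := equilibrium_box i; rewrite in_itv/= => /andP[].
(* A change of quantity s such that s and s / m are at most b, and s + K s is at
   most e. *)
have step (b e : R) : 0 < b -> 0 < e ->
    exists2 s, 0 < s & s <= b /\ (s * m^-1 <= b /\ s * (1 + K) <= e).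
  move=> b0 e0; exists (Num.min (Num.min b (b * m)) (e / (1 + K))).
    by rewrite !lt_min b0 mulr_gt0// divr_gt0.
  split; first by rewrite !ge_min lexx.
  split; first by rewrite ler_pdivrMr// !ge_min lexx orbT.
  by rewrite -ler_pdivlMr// !ge_min lexx orbT.
have upper : Rplus_derive (C i) (p - x i) <= A.
  apply: (ge_Rplus_derive Cd) => e e0.
  have b0 : 0 < Num.min d0 (phat - p) by rewrite lt_min d0_gt0.
  have [s s0 [sb [smb sKe]]] := step _ (e / 2) b0 (divr_gt0 e0 (ltr0Sn R 1)).
  move: sb smb; rewrite !le_min => /andP[sd0 _] /andP[_ smp].
  have sdi := d0P i.
  have Ks : 0 < K * s by rewrite mulr_gt0.
  have ms : 0 < s * m^-1 by rewrite mulr_gt0.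
  exists (p - x i - s); split; first by lra.
  - by rewrite -subr_eq0 addrAC subrr add0r oppr_eq0 gt_eqF.
  - by rewrite subKr gtr0_norm//; lra.
  have -> : p - x i - s - (p - x i) = - s by lra.
  rewrite ler_ndivrMr ?oppr_lt0//.
  have bnd : A * - s - K * (- s) ^+ 2 <= C i (p - x i - s) - C i (p - x i).
    by apply: (equilibrium_FOC_bound i (- s)) => // [j|||]; try have := xpW j; lra.
  have : 0 <= (e - K * s) * s by rewrite mulr_ge0 ?(ltW s0)//; lra.
  by lra.
have lower : A <= Rplus_derive (C i) (p - x i).
  have xi_gt0 : 0 < x i.
    rewrite lt_neqAle xi0 andbT eq_sym; apply/eqP => xiE.
    have := marginal_cost_ge0 (C_cost i) _ (ltW q0).
    have : 0 < (p - x i) / m by rewrite divr_gt0.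
    by move: upper; rewrite /A; lra.
  apply: (le_Rplus_derive Cd) => e e0.
  have b0 : 0 < Num.min d0 (x i / 2) by rewrite lt_min d0_gt0 divr_gt0.
  have [s s0 [sb [smb sKe]]] := step _ (e / 2) b0 (divr_gt0 e0 (ltr0Sn R 1)).
  move: sb smb; rewrite !le_min => /andP[_ sx] /andP[smd smx].
  have Ks : 0 < K * s by rewrite mulr_gt0.
  have ms : 0 < s * m^-1 by rewrite mulr_gt0.
  exists (p - x i + s); split; first by lra.
  - by rewrite -subr_eq0 addrAC subrr add0r gt_eqF.
  - by rewrite opprD [_ + (_ - s)]addrA subrr add0r normrN gtr0_norm//; lra.
  have -> : p - x i + s - (p - x i) = s by lra.
  rewrite ler_pdivlMr//.
  have bnd : A * s - K * s ^+ 2 <= C i (p - x i + s) - C i (p - x i).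
    by apply: equilibrium_FOC_bound => // [j|||]; try have := d0P j; lra.
  have : 0 <= (e - K * s) * s by rewrite mulr_ge0 ?(ltW s0)//; lra.
  by lra.
have /eqP : Rplus_derive (C i) (p - x i) == A by rewrite eq_le upper.
by rewrite /A; lra.
Qed.

End Equilibrium.
End Market.

(** * The supply of a producer at a given price *)

(** The quantity q satisfies the first-order conditions at price p on the
    half-line of nonnegative quantities, when the price falls by 1 / m per unit
    sold: marginal revenue p - q - q / m at most C' q, with equality if q > 0. *)
Definition supply_at {R : realType} (m : R) (C : R -> R) (p q : R) : Prop :=
  [/\ 0 <= q, p <= q + q / m + Rplus_derive C q &
      0 < q -> q + q / m + Rplus_derive C q = p].

Section Supply.
Context {R : realType} {m : R} {C : R -> R}.
Hypotheses (m_gt0 : 0 < m) (C_cost : production_cost C).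

Lemma supply_le (p p' q q' : R) : p <= p' ->
  supply_at m C p q -> supply_at m C p' q' -> q <= q'.
Proof.
move=> pp [q0 _ qE] [q'0 q'p _]; rewrite leNgt; apply/negP => qq.
have := qE (le_lt_trans q'0 qq).
have := marginal_cost_homo C_cost q' q q'0 (ltW qq).
have : q' / m < q / m by rewrite ltr_pM2r ?invr_gt0.
by lra.
Qed.

Lemma supply_lipschitz (p p' q q' : R) : p <= p' ->
  supply_at m C p q -> supply_at m C p' q' -> q' <= q + (p' - p).
Proof.
move=> pp [q0 qp _] [q'0 _ q'E]; rewrite leNgt; apply/negP => qq.
have qq' : q < q' by lra.
have := q'E (le_lt_trans q0 qq').
have := marginal_cost_homo C_cost q q' q0 (ltW qq').
have : q / m < q' / m by rewrite ltr_pM2r ?invr_gt0.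
by lra.
Qed.

Lemma supply_uniq (p q q' : R) : supply_at m C p q -> supply_at m C p q' -> q = q'.
Proof.
by move=> sq sq'; apply/eqP; rewrite eq_le (supply_le _ _ _ _ _ sq sq')//
  (supply_le _ _ _ _ _ sq' sq).
Qed.

Lemma supply_le_price (p q : R) : 0 <= p -> supply_at m C p q -> q <= p.
Proof.
move=> p0 [q0 _ qE]; move: q0; rewrite le_eqVlt => /orP[/eqP<-//|q0].
rewrite -(qE q0); have := marginal_cost_ge0 C_cost q (ltW q0).
have : 0 < q / m by rewrite divr_gt0.
by lra.
Qed.

Lemma supply_exists (p : R) : exists q, supply_at m C p q.
Proof.
have [pc|cp] := leP p (Rplus_derive C 0).
  by exists 0; split; rewrite ?ltxx ?mul0r ?add0r.
have p0 : 0 < p by apply: le_lt_trans cp; exact: marginal_cost_ge0.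
pose f q := q + q / m + Rplus_derive C (Num.max q 0).
have fc : continuous f.
  move=> q; apply: cvgD; last first.
    exact: continuous_Rplus_extension (marginal_cost_derivable C_cost) q.
  by apply: cvgD; [exact: cvg_id|apply: cvgM; [exact: cvg_id|exact: cvg_cst]].
have f0 : f 0 <= p by rewrite /f maxxx mul0r !add0r ltW.
have fp : p <= f p.
  rewrite /f (max_idPl (ltW p0)).
  have := marginal_cost_ge0 C_cost p (ltW p0).
  have : 0 < p / m by rewrite divr_gt0.
  by lra.
have [|q] := @IVT R f 0 p p (ltW p0) (continuous_subspaceT fc).
  by rewrite ge_min f0 le_max fp orbT.
rewrite in_itv/= => /andP[q0 _]; rewrite /f (max_idPl q0) => qE.
by exists q; split; rewrite ?qE.
Qed.

End Supply.

(** * Equilibria are the market-clearing supplies *)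

Section Characterization.
Context {R : realType} {n : nat} {gamma phat : R} {C : 'I_n -> R -> R}.
Hypotheses (gamma_gt0 : 0 < gamma) (phat_gt0 : 0 < phat).
Hypothesis C_cost : forall i, production_cost (C i).
Local Notation m := (n%:R + gamma - 1).

(** At price p, the q i are supplies and add up to the demand. *)
Definition supply_clears (p : R) (q : 'I_n -> R) : Prop :=
  (forall i, supply_at m (C i) p (q i)) /\ \sum_(i < n) q i = gamma * (phat - p).

Lemma supply_clears_equilibrium (p : R) (q : 'I_n -> R) :
  0 <= p <= phat -> supply_clears p q ->
  activation_price_equilibrium gamma phat C (fun i => p - q i).
Proof.
move=> /andP[p0 pp] [sq clr].
set x := fun i => p - q i.
have qp i : q i <= p.
  by have /supply_le_price := sq i; apply => //; exact: (slope_gt0 gamma_gt0 i).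
have q0 i : 0 <= q i by case: (sq i).
have xb i : x i \in `[0, phat].
  by rewrite in_itv/= /x; have := qp i; have := q0 i; lra.
have pE : p = clearing_price gamma phat x.
  apply/(clearing_price_spec _ gamma_gt0 phat_gt0 xb); split.
    by rewrite in_itv/= p0.
  rewrite /demand -clr; apply: eq_bigr => i _.
  by rewrite /x subKr pospart_id.
split=> [i|i t tb]; first by have := xb i.
rewrite utility_update utilityE -pE {2}/x subKr (pospart_id (q0 i)).
have [] := clearing_price_clears gamma_gt0 phat_gt0 (update_box xb i t tb).
set p' := clearing_price _ _ _; rewrite in_itv/= => /andP[p'0 _].
rewrite /demand update_supply; set r := pospart _ => clr'.
have r0 : 0 <= r := pospart_ge0 _.
have m0 := slope_gt0 gamma_gt0 i; have mV0 : 0 < m^-1 by rewrite invr_gt0.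
have := others_supply_ge (x := x) i p'.
have -> : \sum_(j < n) x j = n%:R * p - gamma * (phat - p).
  by rewrite /x sumrB clr sumr_const card_ord mulr_natl.
have [_ qp' qE] := sq i.
have := cost_tangent (C_cost i) _ _ (q0 i) r0.
(* After the deviation i sells r at price p'; u is its former quantity. *)
rewrite /x; move: (q i) (q0 i) qp' qE => u u0 up uE tang others.
(* The residual demand curve lies below the line of slope - m. *)
have p'_le : (r - u) / m <= p - p' by rewrite ler_pdivrMr//; lra.
have kkt : (r - u) * (p - u - u / m - Rplus_derive (C i) u) <= 0.
  move: u0; rewrite le_eqVlt => /orP[/eqP uE0|u0].
    by rewrite mulr_ge0_le0//; lra.
  have -> : p - u - u / m - Rplus_derive (C i) u = 0 by have := uE u0; lra.
  by rewrite mulr0.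
have : p' * r <= (p - (r - u) / m) * r by rewrite ler_wpM2r//; lra.
have : 0 <= (r - u) ^+ 2 * m^-1 by rewrite mulr_ge0 ?sqr_ge0// ltW.
have := sqr_ge0 (r - u).
rewrite /payoff.
by lra.
Qed.

Lemma supply_clears_exists :
  exists p, exists q, 0 <= p <= phat /\ supply_clears p q.
Proof.
have S_ex (ip : 'I_n * R) : exists q, supply_at m (C ip.1) ip.2 q.
  by apply: supply_exists => //; exact: (slope_gt0 gamma_gt0 ip.1).
have [S SP] := choice S_ex.
have S_cont i : continuous (fun p => S (i, p)).
  move=> p; apply/cvgrPdist_lt => e e0; apply/nbhs_ballP; exists e => //= p' pp'.
  apply: le_lt_trans pp'; have m0 := slope_gt0 gamma_gt0 i.
  wlog le_pp : p p' / p <= p'.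
    by move=> H; case: (leP p p') => [|/ltW] /H //; rewrite distrC (distrC p').
  have := supply_le m0 (C_cost i) _ _ _ _ le_pp (SP (i, p)) (SP (i, p')).
  have := supply_lipschitz m0 (C_cost i) _ _ _ _ le_pp (SP (i, p)) (SP (i, p')).
  rewrite (distrC p p') (ger0_norm (_ : 0 <= p' - p)) ?subr_ge0//.
  by move=> ? ?; rewrite ler_norml; lra.
pose F p := \sum_(i < n) S (i, p) - gamma * (phat - p).
have F_cont : continuous F.
  move=> p; apply: cvgB.
    by apply: continuous_big => [|i _]; [exact: add_continuous|exact: S_cont].
  apply: cvgM; first exact: cvg_cst.
  by apply: cvgB; [exact: cvg_cst|exact: cvg_id].
have F0 : F 0 <= 0.
  rewrite /F big1 => [|i _]; first by rewrite sub0r oppr_le0 ltW// subr0 mulr_gt0.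
  apply/eqP; rewrite eq_le; have [-> _ _] := SP (i, 0); rewrite andbT.
  by apply: supply_le_price (SP (i, 0)); first exact: (slope_gt0 gamma_gt0 i).
have Fp : 0 <= F phat.
  rewrite /F subrr mulr0 subr0 sumr_ge0// => i _.
  by have [] := SP (i, phat).
have [|p pI Fp0] := @IVT R F 0 phat 0 (ltW phat_gt0) (continuous_subspaceT F_cont).
  by rewrite ge_min F0 le_max Fp orbT.
exists p, (fun i => S (i, p)); split; first by move: pI; rewrite in_itv.
split; first by move=> i; exact: SP (i, p).
by apply/eqP; rewrite -subr_eq0; apply/eqP.
Qed.

Lemma supply_clears_price_le (p p' : R) (q q' : 'I_n -> R) :
  supply_clears p q -> supply_clears p' q' -> p' <= p.
Proof.
move=> [sq clr] [sq' clr']; rewrite leNgt; apply/negP => pp.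
have : \sum_(i < n) q i <= \sum_(i < n) q' i.
  apply: ler_sum => i _.
  exact: supply_le (slope_gt0 gamma_gt0 i) (C_cost i) _ _ _ _ (ltW pp) (sq i) (sq' i).
rewrite clr clr' ler_pM2l//; lra.
Qed.

Lemma supply_clears_uniq (p p' : R) (q q' : 'I_n -> R) :
  supply_clears p q -> supply_clears p' q' -> p = p' /\ q = q'.
Proof.
move=> sq sq'.
have pp : p = p'.
  apply/eqP; rewrite eq_le (supply_clears_price_le _ _ _ _ sq' sq).
  by rewrite (supply_clears_price_le _ _ _ _ sq sq').
split=> //; apply/funext => i; case: sq sq' => sq _ [sq' _].
apply: supply_uniq (slope_gt0 gamma_gt0 i) (C_cost i) _ _ _ (sq i) _.
by rewrite pp; exact: sq'.
Qed.

Hypothesis C_homogeneous : forall i j : 'I_n,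
  Rplus_derive (C i) 0 = Rplus_derive (C j) 0.

Lemma equilibrium_supply_clears (x : 'I_n -> R) :
  activation_price_equilibrium gamma phat C x ->
  let p := clearing_price gamma phat x in
  (forall i, x i <= p) /\ supply_clears p (fun i => p - x i).
Proof.
move=> xeq p.
have clr := equilibrium_clears gamma_gt0 phat_gt0 xeq.
have concl : (forall i, x i <= p) -> (forall i, supply_at m (C i) p (p - x i)) ->
    (forall i, x i <= p) /\ supply_clears p (fun i => p - x i).
  move=> xp sp; split=> //; split=> //; rewrite /p clr.
  by apply: eq_bigr => i _; rewrite pospart_id// subr_ge0.
have [/existsP[i pxi]|] := boolP [exists i, p <= x i].
  have pc j : p <= Rplus_derive (C j) 0.
    by rewrite (C_homogeneous j i); exact: equilibrium_inactive.
  have px j : p <= x j by exact: (equilibrium_no_supply gamma_gt0 phat_gt0 xeq C_cost j (pc j)).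
  have p_phat : p = phat.
    move: clr; rewrite big1 => [/eqP|j _]; last first.
      by apply: pospart_eq0; rewrite subr_le0; exact: px.
    by rewrite mulf_eq0 gt_eqF//= subr_eq0 => /eqP.
  have xE j : x j = p.
    apply/eqP; rewrite eq_le px andbT p_phat.
    by have := equilibrium_box xeq j; rewrite in_itv/= => /andP[].
  apply: concl => j; first by rewrite xE.
  by rewrite xE subrr; split; rewrite ?ltxx ?mul0r ?add0r.
rewrite negb_exists => /forallP xp.
have xp' j : x j < p by rewrite ltNge xp.
apply: concl => j; first exact: ltW.
have E := equilibrium_FOC gamma_gt0 phat_gt0 xeq C_cost j xp'.
by rewrite -/p in E; split; rewrite ?E// subr_ge0 ltW.
Qed.

End Characterization.

Theorem theorem2 (R : realType) (n : nat) (gamma phat : R)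
    (C : 'I_n -> R -> R)
    (n_gt0 : (0 < n)%N) (gamma_gt0 : 0 < gamma) (phat_gt0 : 0 < phat)
    (C_cost : forall i : 'I_n, production_cost (C i))
    (C_homogeneous : forall i j : 'I_n,
        Rplus_derive (C i) 0 = Rplus_derive (C j) 0) :
  (exists! x : 'I_n -> R, activation_price_equilibrium gamma phat C x) /\
  (forall x : 'I_n -> R, activation_price_equilibrium gamma phat C x ->
   (forall i : 'I_n, Rplus_derive (C i) 0 <= phat) ->
   forall i : 'I_n,
     ptilde gamma phat x - (n%:R + gamma) * x i
     + (n%:R + gamma - 1) * Rplus_derive (C i) (ptilde gamma phat x - x i) = 0).
Proof.
split.
  have [p [q [pI sq]]] := supply_clears_exists gamma_gt0 phat_gt0 C_cost.
  exists (fun i => p - q i); split; first exact: supply_clears_equilibrium.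
  move=> y yeq; have [_] :=
    equilibrium_supply_clears gamma_gt0 phat_gt0 C_cost C_homogeneous _ yeq.
  set p' := clearing_price _ _ _ => sq'.
  have [-> ->] := supply_clears_uniq gamma_gt0 C_cost _ _ _ _ sq sq'.
  by apply/funext => i; rewrite subKr.
move=> x xeq c_phat i; have [xp [sq clr]] :=
  equilibrium_supply_clears gamma_gt0 phat_gt0 C_cost C_homogeneous _ xeq.
set p := clearing_price gamma phat x in xp sq clr.
have m0 := slope_gt0 gamma_gt0 i.
have -> : ptilde gamma phat x = p.
  have N0 : n%:R + gamma != 0 by rewrite gt_eqF//; lra.
  apply: (canLR (mulfK N0)).
  by move: clr; rewrite sum_price_gap; lra.
(* If q_i = 0 then p <= C_i' 0; by homogeneity nobody sells, so that
   p = phat >= C_i' 0, and the first-order equation holds at 0. *)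
have foc : p - x i + (p - x i) / (n%:R + gamma - 1) + Rplus_derive (C i) (p - x i) = p.
  have [q0 pq qE] := sq i.
  move: q0; rewrite le_eqVlt => /orP[/eqP q0|/qE//].
  rewrite -q0 mul0r !add0r in pq *.
  have q_eq0 j : p - x j = 0.
    have [qj0 _ qjE] := sq j; move: qj0; rewrite le_eqVlt => /orP[/eqP//|qj0].
    have := marginal_cost_homo (C_cost j) 0 _ (lexx 0) (ltW qj0).
    have : 0 < (p - x j) / (n%:R + gamma - 1) by rewrite divr_gt0.
    by have := qjE qj0; rewrite (C_homogeneous j i); lra.
  move: clr; rewrite big1// => /esym/eqP.
  rewrite mulf_eq0 gt_eqF//= subr_eq0 => /eqP pE.
  by apply/eqP; rewrite eq_le pq -pE c_phat.
have : (p - x i) / (n%:R + gamma - 1) * (n%:R + gamma - 1) = p - x i.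
  by rewrite divfK// gt_eqF.
move: foc; set D := Rplus_derive _ _; set w := _ / _ => foc.
have -> : D = p - (p - x i) - w by lra.
by lra.
Qed.
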